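(* Let $G=\langle V,E\rangle$ be a finite simple undirected graph with vertex set $V=\{1,\dots,n\}$. For each vertex $i$ let $N(i)=\{j\in V : (i,j)\in E\}$ and $N[i]=N(i)\cup\{i\}$, and let $\mathrm{dist}(i,j)$ denote the graph distance. Consider the system in binary variables $x_j$ ($j\in V$) and real variables $y_{ij}$ (one for each ordered pair $(i,j)$ with $j\in N(i)$): \begin{align*} &\sum_{j\in N[i]} x_j \ge 1 && \forall i\in V,\\ &y_{ij}-x_i\le 0 && \forall i\in V,\ \forall j\in N(i),\\ &\sum_{k\in N[i]} x_k-\sum_{k\in N(i)\cap N(j)} y_{kj}\ge 1 && \forall j\in V,\ \forall i\in V \text{ with } \mathrm{dist}(i,j)=2,\\ &x_j+\sum_{i\in N(j)} y_{ij}=1 && \forall j\in V,\\ &y_{ij}\ge 0 && \forall i\in V,\ \forall j\in N(i),\\ &x_j\in\{0,1\} && \forall j\in V. \end{align*} Then the solutions of this system correspond precisely to the secure dominating sets of $G$; that is, a set $S\subseteq V$ is a secure dominating set of $G$ if and only if there exist values of the variables $y_{ij}$ such that $x$, defined by $x_j=1$ if $j\in S$ and $x_j=0$ otherwise, together with these $y_{ij}$ satisfies all the constraints above.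
   Context: A set $D\subseteq V$ is a dominating set of $G$ if for every vertex $v\in V$ we have $N[v]\cap D\neq\emptyset$. A dominating set $D$ is secure if for every vertex $v\in V$ there exists a vertex $w\in N[v]\cap D$ such that $(D\setminus\{w\})\cup\{v\}$ is also a dominating set of $G$. *)

(* Defs.v *)
From mathcomp Require Import all_boot all_order all_algebra.
From mathcomp Require Import reals.

Set Implicit Arguments.
Unset Strict Implicit.
Unset Printing Implicit Defensive.

Import Order.TTheory GRing.Theory Num.Theory.

Section Graph.
Variables (T : finType) (e : rel T).

Definition nbhd (v : T) : {set T} := [set w | e v w].

Definition cnbhd (v : T) : {set T} := v |: nbhd v.

Definition walk (x y : T) (d : nat) : bool :=
  [exists p : d.-tuple T, path e x p && (last x p == y)].

Lemma walkP x y d :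
  reflect (exists p : seq T, [/\ path e x p, last x p = y & size p = d])
          (walk x y d).
Proof.
apply: (iffP existsP) => [[p /andP[ep /eqP lp]]|[p [ep lp sp]]].
  by exists p; rewrite size_tuple.
by exists (Tuple (introT eqP sp)); rewrite /= ep lp eqxx.
Qed.

Lemma connect_walk x y : connect e x y -> exists d, walk x y d.
Proof.
by move=> /connectP[p ep lp]; exists (size p); apply/walkP; exists p.
Qed.

(* [None] is the distance between vertices in different components. *)
Definition gdist (x y : T) : option nat :=
  if @idP (connect e x y) is ReflectT xy then Some (ex_minn (connect_walk xy))
  else None.

Lemma gdistP x y d :
  gdist x y = Some d <->
  walk x y d /\ (forall d', walk x y d' -> (d <= d')%N).
Proof.
rewrite /gdist; case: {-}_ / idP => [xy|nxy].
  case: ex_minnP => m wm min_m; split=> [[<-] //|[wd min_d]].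
  by congr Some; apply/eqP; rewrite eqn_leq min_m // min_d.
split=> // -[/walkP[p [ep lp _]] _].
by case: nxy; apply/connectP; exists p.
Qed.

Definition dominating (D : {set T}) : bool :=
  [forall v, cnbhd v :&: D != set0].

Definition secure_dominating (D : {set T}) : bool :=
  dominating D &&
  [forall v, exists w in cnbhd v :&: D, dominating ((D :\ w) :|: [set v])].

End Graph.

Local Open Scope ring_scope.

(* The variable y_ij exists only for j in N(i).  Here [y] is a total function,
   but no constraint reads [y i j] when [i] and [j] are not adjacent. *)
Record sds_system (R : realType) (n : nat) (e : rel 'I_n)
    (x : 'I_n -> R) (y : 'I_n -> 'I_n -> R) : Prop := SdsSystem {
  sds_cover : forall i, \sum_(j in cnbhd e i) x j >= 1;
  sds_le : forall i j, j \in nbhd e i -> y i j - x i <= 0;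
  sds_dist2 : forall j i, gdist e i j = Some 2%N ->
    \sum_(k in cnbhd e i) x k - \sum_(k in nbhd e i :&: nbhd e j) y k j >= 1;
  sds_defend : forall j, x j + \sum_(i in nbhd e j) y i j = 1;
  sds_ge0 : forall i j, j \in nbhd e i -> 0 <= y i j;
  sds_binary : forall j, x j = 0 \/ x j = 1
}.

(* Main.v *)
Require Import Defs.
From mathcomp Require Import all_boot all_order all_algebra.
From mathcomp Require Import reals.

(** Read [y i j] as the fraction of the defence of [j] assigned to its
    neighbour [i].  From a secure dominating set one gets an integral solution
    by letting each vertex outside [S] be defended by a single neighbour [w].
    Conversely, any [w] with [y w j > 0] defends [j]: moving the guard from [w]
    to [j] can only expose a vertex [i] adjacent to [w] but not to [j], that
    is, at distance 2 from [j], and there the distance constraint forces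
    [#|N[i] :&: S| > 1] by integrality of [x]. *)

Set Implicit Arguments.
Unset Strict Implicit.
Unset Printing Implicit Defensive.

Import Order.TTheory GRing.Theory Num.Theory.

Local Open Scope ring_scope.

Section Domination.
Variables (T : finType) (e : rel T).

(** Walks of length 0 and 1 are exactly equality and adjacency, so minimality of 2 amounts to
    excluding both. *)
Lemma gdist_eq2 (x y : T) :
  gdist e x y = Some 2%N <->
  [/\ x != y, ~~ e x y & exists2 z, e x z & e z y].
Proof.
split=> [/gdistP[/walkP[p [ep lp sp]] min2]|[xNy exyN [z exz ezy]]].
- split.
  + apply/negP => /eqP xy.
    have walk0 : walk e x y 0 by apply/walkP; exists [::].
    by have := min2 _ walk0.
  + apply/negP => exy.
    have walk1 : walk e x y 1 by apply/walkP; exists [:: y]; rewrite /= exy.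
    by have := min2 _ walk1.
  + case: p ep lp sp => [|z [|t [|]]] //= /and3P[exz ezt _] <- _.
    by exists z.
- apply/gdistP; split=> [|[|[|d]] //].
  + by apply/walkP; exists [:: z; y]; rewrite /= exz ezy.
  + case/walkP=> p [_ xy /size0nil p0].
    by move: xNy; rewrite -xy p0 eqxx.
  + case/walkP=> -[|t [|? ?]] [/= ep ty // _].
    by move: ep; rewrite ty (negbTE exyN).
Qed.

Lemma dominatingP (D : {set T}) :
  reflect (forall v, exists2 u, u \in cnbhd e v & u \in D) (dominating e D).
Proof.
apply: (iffP forallP) => dom v; have := dom v.
  by case/set0Pn => u /setIP[uv uD]; exists u.
by case=> u uv uD; apply/set0Pn; exists u; apply/setIP.
Qed.

Lemma sum_mem_card (R : pzRingType) (A S : {set T}) :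
  \sum_(j in A) (if j \in S then 1 else 0) = #|A :&: S|%:R :> R.
Proof.
rewrite -big_mkcondr sumr_const; congr (_ *+ _).
by apply: eq_card => j; rewrite !inE.
Qed.

End Domination.

Lemma secure_dominating_system (R : realType) (n : nat) (e : rel 'I_n)
    (S : {set 'I_n}) : secure_dominating e S ->
  exists y : 'I_n -> 'I_n -> R,
    sds_system e (fun j => if j \in S then 1 else 0) y.
Proof.
move=> /andP[/dominatingP domS /forallP secS].
pose defends j w :=
  (w \in cnbhd e j :&: S) && dominating e ((S :\ w) :|: [set j]).
have /fin_all_exists[f fP] j : exists w, defends j w by apply/existsP/secS.
have card_gt0 i : (0 < #|cnbhd e i :&: S|)%N.
  by case: (domS i) => u ui uS; apply/card_gt0P; exists u; apply/setIP.
have f_in_S j : f j \in S by case/andP: (fP j) => /setIP[].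
have f_nbhd j : j \notin S -> f j \in nbhd e j.
  move=> jS; case/andP: (fP j) => /setIP[/setU1P[fj|//] _] _.
  by rewrite -fj f_in_S in jS.
(* The value is 0 for [j] in [S]: there [x j = 1] already exhausts the total 1 in the defence
   equation. *)
exists (fun i j => ((j \notin S) && (i == f j))%:R); split=> /=.
- by move=> i; rewrite sum_mem_card ler1n.
- move=> i j _; rewrite subr_le0; case: andP => [[_ /eqP ->]|_].
    by rewrite f_in_S.
  by case: ifP.
- move=> j i /gdist_eq2[ij eijN _]; rewrite sum_mem_card.
  have [jS|jS] := boolP (j \in S); first by rewrite big1 // subr0 ler1n.
  (* Only [k = f j] can contribute to the [y]-sum; if it is not adjacent to [i], the covering bound
     suffices. *)
  have [fi|fNi] := boolP (f j \in nbhd e i); last first.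
    rewrite big1 ?subr0 ?ler1n // => k /setIP[ki _].
    by case: eqP => //= kf; rewrite -kf ki in fNi.
  rewrite (bigD1 (f j)) /=; last by rewrite inE fi f_nbhd.
  rewrite eqxx big1 ?addr0 => [|k /andP[_ /negbTE ->] //].
  (* The sum is 1, so [i] needs a guard besides [f j]: the one dominating [i] after the swap, which
     is not [j] because [i] and [j] are distinct and non-adjacent. *)
  rewrite lerBrDr -[1 + _]/2%:R ler_nat (cardsD1 (f j)) inE in_setU1 fi orbT f_in_S.
  rewrite ltnS; apply/card_gt0P.
  case/andP: (fP j) => _ /dominatingP/(_ i)[u ui].
  case/setUP=> [/setD1P[uf uS]|/set1P uj].
    by exists u; rewrite !inE uf uS; move: ui; rewrite !inE => ->.
  by move: ui; rewrite uj !inE eq_sym (negbTE ij) (negbTE eijN).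
- move=> j; have [jS|jS] /= := boolP (j \in S); first by rewrite big1 ?addr0.
  rewrite add0r (bigD1 (f j)) ?f_nbhd //= eqxx big1 ?addr0 // => i.
  by case/andP=> _ /negbTE ->.
- by [].
- by move=> j; case: ifP; [right|left].
Qed.

Lemma system_secure_dominating (R : realType) (n : nat) (e : rel 'I_n)
    (S : {set 'I_n}) (y : 'I_n -> 'I_n -> R) : symmetric e ->
  sds_system e (fun j => if j \in S then 1 else 0) y ->
  secure_dominating e S.
Proof.
move=> e_sym [cover y_le dist2 defend y_ge0 _].
have domS v : exists2 u, u \in cnbhd e v & u \in S.
  have := cover v; rewrite sum_mem_card ler1n => /card_gt0P[u /setIP[]].
  by exists u.
apply/andP; split; first exact/dominatingP.
apply/forallP => j; have [jS|jS] := boolP (j \in S).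
  (* A guard at [j] defends itself: the swap gives back [S]. *)
  apply/existsP; exists j; rewrite !inE eqxx jS /=.
  by rewrite setUC setD1K //; apply/dominatingP.
have [w wj yw_gt0] : exists2 w, w \in nbhd e j & 0 < y w j.
  apply/exists_inP; apply: contraT => /exists_inPn y_le0.
  have := defend j; rewrite (negbTE jS) add0r => sum1.
  have : \sum_(i in nbhd e j) y i j <= 0.
    by apply: sumr_le0 => i /y_le0; rewrite -leNgt.
  by rewrite sum1 ler10.
have jw : j \in nbhd e w by move: wj; rewrite !inE e_sym.
have wS : w \in S.
  have := y_le _ _ jw; case: ifP => // _.
  by rewrite subr0 leNgt yw_gt0.
apply/existsP; exists w; rewrite !inE wS andbT.
move: (wj); rewrite inE => ->; rewrite orbT /=.
apply/dominatingP => v.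
have [jv|jNv] := boolP (j \in cnbhd e v).
  by exists j; rewrite // !inE eqxx orbT.
(* As [j] does not dominate [v], a guard of [v] that stays in place is needed. *)
have [u uv /andP[uw uS]] : exists2 u, u \in cnbhd e v & (u != w) && (u \in S).
  have [wv|wNv] := boolP (w \in cnbhd e v); last first.
    case: (domS v) => u uv uS; exists u => //.
    by rewrite uS andbT; apply: contraNneq wNv => <-.
  move: jNv; rewrite !inE negb_or => /andP[jv evjN].
  (* [v = w] is impossible, since [w] is adjacent to [j] and [v] is not. *)
  have evw : e v w.
    case/setU1P: wv => [wv|]; last by rewrite inE.
    by move: jw evjN; rewrite inE wv => ->.
  have d2 : gdist e v j = Some 2%N.
    apply/gdist_eq2; split=> //; first by rewrite eq_sym.
    by exists w => //; move: jw; rewrite inE.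
  have := dist2 j v d2; rewrite sum_mem_card lerBrDr.
  have w_common : w \in nbhd e v :&: nbhd e j by rewrite inE wj inE evw.
  (* Isolating the term [y w j > 0], with the others nonnegative, makes the number of guards in
     [cnbhd e v] exceed 1, so one differs from [w]. *)
  rewrite (bigD1 w) //= => le_card.
  have : 1 < #|cnbhd e v :&: S|%:R :> R.
    apply: lt_le_trans le_card; rewrite ltrDl ltr_pwDl // sumr_ge0 // => i.
    by case/andP=> /setIP[_ ij] _; apply: y_ge0; move: ij; rewrite !inE e_sym.
  rewrite ltr1n (cardsD1 w) inE wv wS ltnS => /card_gt0P[u].
  by rewrite !inE => /and3P[uw uv uS]; exists u; rewrite ?uw // !inE.
by exists u; rewrite // !inE uw uS.
Qed.

Theorem theorem1 (R : realType) (n : nat) (e : rel 'I_n)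
    (e_sym : symmetric e) (e_irr : irreflexive e) (S : {set 'I_n}) :
  secure_dominating e S <->
  exists y : 'I_n -> 'I_n -> R,
    sds_system e (fun j => if j \in S then 1 else 0) y.
Proof.
split; first exact: secure_dominating_system.
by case=> y; apply: system_secure_dominating.
Qed.
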